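(* Let \[ \lambda_4=\left(\frac{181}{512}\right)^{1/4},\qquad c_4=\frac32+\log_2\lambda_4=1.1249614\ldots . \] There is an absolute constant $C_4$ such that, for all integers $d,n$ with $n-d\geq 4$, \[ \Delta_u(d,n)\leq C_4\,(n-d)\,T_{\lambda_4(n-d)}, \] and consequently \[ \Delta_u(d,n)\leq (n-d)^{\frac12\log_2(n-d)+c_4+O\left(\frac{1}{\ln(n-d)}\right)}, \] where the constant implicit in $O(\cdot)$ is absolute.
   Context: For real $\sigma>0$, $T_\sigma=\sum_{L\ge 0}\sigma^L 2^{-L(L-1)/2}$, the sum being over all integers $L\geq 0$. A polyhedron is a finite intersection of closed half-spaces; it is pointed if it has at least one vertex. The graph of a pointed polyhedron has its vertices as nodes, two of them being adjacent if they are the endpoints of a (bounded) edge of the polyhedron. The diameter of a pointed polyhedron is the diameter of this graph. $\Delta_u(d,n)$ denotes the maximum diameter of a pointed $d$-dimensional polyhedron (bounded or unbounded) with $n$ facets; it is considered for those pairs $(d,n)$ for which such polyhedra exist (for $d\ge2$, all $n\ge d$). *)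

(* Defs.v *)
From HB Require Import structures.
From mathcomp Require Import all_boot all_order all_algebra.
From mathcomp Require Import all_classical all_reals all_analysis.

Set Implicit Arguments.
Unset Strict Implicit.
Unset Printing Implicit Defensive.

Import Order.TTheory GRing.Theory Num.Theory.
Import numFieldNormedType.Exports.

Local Open Scope classical_set_scope.
Local Open Scope ring_scope.

Section Polyhedra.
Context {R : realType}.

Section Ambient.
Variable m : nat.
Implicit Types (a u v : 'rV[R]_m) (S P F H E : set 'rV[R]_m).

Definition dot a u : R := \sum_(j < m) a 0 j * u 0 j.

Definition closed_halfspace H : Prop :=
  exists a, a != 0 /\ exists b : R, H = [set x | dot a x <= b].

Definition polyhedron P : Prop :=
  exists k (H : 'I_k -> set 'rV[R]_m),
    (forall i, closed_halfspace (H i)) /\ P = \bigcap_(i in setT) H i.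

Definition affine_hull S : set 'rV[R]_m :=
  [set x | exists k (p : 'I_k -> 'rV[R]_m) (w : 'I_k -> R),
    [/\ forall i, S (p i), \sum_(i < k) w i = 1
      & x = \sum_(i < k) w i *: p i]].

(* The rows of U form a basis of the direction of the affine hull.
   The empty set has no dimension in this sense. *)
Definition has_dim S (k : nat) : Prop :=
  exists (x0 : 'rV[R]_m) (U : 'M[R]_(k, m)),
    row_free U /\ affine_hull S = [set x | (x - x0 <= U)%MS].

(* a = 0 is allowed, so that P itself is a face of P; so is the empty set. *)
Definition is_face P F : Prop :=
  exists a (b : R),
    (forall x, P x -> dot a x <= b) /\ F = P `&` [set x | dot a x = b].

Definition is_facet P F : Prop :=
  exists k : nat, [/\ has_dim P k.+1, is_face P F & has_dim F k].

Definition is_vertex P v : Prop := is_face P [set v].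

Definition pointed P : Prop := exists v, is_vertex P v.

Definition is_edge P E : Prop := is_face P E /\ has_dim E 1.

Definition closed_segment u v : set 'rV[R]_m :=
  [set x | exists t : R, 0 <= t <= 1 /\ x = (1 - t) *: u + t *: v].

(* The bounded edges are the edges which are closed segments. *)
Definition vertex_adjacent P u v : Prop :=
  [/\ is_vertex P u, is_vertex P v & is_edge P (closed_segment u v)].

End Ambient.

Section Graph.
Variables (T : Type) (V : set T) (e : T -> T -> Prop).

(* Minimal number of edges of a walk from u to v, +oo if there is none. *)
Definition graph_dist (u v : T) : \bar R :=
  ereal_inf [set (size s)%:R%:E | s in
    [set s : seq T | path (fun x y => `[< e x y >]) u s /\ last u s = v]].

Definition graph_diam : \bar R :=
  ereal_sup [set l | exists u v, [/\ V u, V v & l = graph_dist u v]].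

End Graph.

Definition diameter m (P : set 'rV[R]_m) : \bar R :=
  graph_diam (is_vertex P) (vertex_adjacent P).

(* The polyhedra may live in any R^m, d being the dimension of their affine
   hull.  The diameters are taken in N U {+oo}, so a finite supremum over a
   nonempty family is a maximum; Delta_u d n = -oo when no such polyhedron
   exists. *)
Definition Delta_u (d n : nat) : \bar R :=
  ereal_sup [set D | exists m (P : set 'rV[R]_m),
    [/\ polyhedron P, pointed P, has_dim P d,
        ([set F | is_facet P F] #= `I_n)%card & D = diameter P]].

End Polyhedra.

Section Constants.
Context {R : realType}.

Definition log2 (x : R) : R := ln x / ln 2.

(* The series converges for every sigma. *)
Definition T_ (sigma : R) : R :=
  limn (series (fun L : nat => sigma ^+ L * 2 ^- (L * L.-1)./2)).

Definition lambda4 : R := (181 / 512) `^ (1 / 4).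

Definition c4 : R := 3 / 2 + log2 lambda4.

End Constants.

Arguments Delta_u : clear implicits.
Arguments lambda4 : clear implicits.
Arguments c4 : clear implicits.

(* Main.v *)
Require Import Defs.
From HB Require Import structures.
From mathcomp Require Import all_boot all_order all_algebra.
From mathcomp Require Import all_classical all_reals all_analysis.
From mathcomp Require Import zify ring lra.

Import Order.TTheory GRing.Theory Num.Theory.
Import numFieldNormedType.Exports.

Local Open Scope classical_set_scope.
Local Open Scope ring_scope.

Set Implicit Arguments.
Unset Strict Implicit.
Unset Printing Implicit Defensive.

(**
The proof is a refinement of the argument of Kalai and Kleitman.  Fix a
polyhedron of dimension d given by n inequalities, and two vertices u and v.
Let B be the set of inequalities tight at some vertex within distance t of u.

If B contains at most n / 2 inequalities, they define a relaxed polyhedron, of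
dimension d with n / 2 inequalities.  Walks of length at most t from u in the
relaxation never leave the original polyhedron ([relaxation_walk]), so if t
exceeds the diameter of the relaxation, all its vertices are vertices of the
original one, and v must be among them ([few_touched]).  Otherwise the sets
for u and v have a common element, and the two vertices can be joined
through the corresponding face, of dimension d - 1 with n - 1 inequalities.

In terms of the excess k = n - d, the face has the same excess k and the
relaxation has the excess (k - d) / 2; for d > k every vertex already lies on
more than half of the inequalities, so t = 0 will do.  Summing over the
dimensions min(d, k), ..., 1 gives a bound G(k) on the diameter that depends on
k only, for any G with
  sum over i < k of (2 G(floor(i / 2)) + 2) <= G(k)   ([system_diameter]).

The function G(k) = 2 k T(k / 2) satisfies this inequality, by the functional
equation T(s) = 1 + s T(s / 2) and monotonicity of T ([T_supersolution]).
Since 1 / 2 <= lambda4, the first bound follows with the constant 2.  For the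
second one, T(s) is compared with the solution 2 ^ ((log2 s + 1 / 2) ^ 2 / 2) of
the homogeneous equation f(s) = s f(s / 2) ([T_le_gauss]), and the square in the
exponent is expanded.

The recursion is run on systems of inequalities in a fixed space, where vertices
and edges are defined through tight constraints.  A polyhedron with n facets
is described, inside its affine hull, by an irredundant system, and such a
system has at most n inequalities since each of them yields its own facet
([card_le_facets]).
*)

(** * Walks in a graph *)

Section Walks.
Context {T : Type}.
Implicit Types (e : T -> T -> Prop) (u v w : T).

Inductive reach e : nat -> T -> T -> Prop :=
| reach_refl n u : reach e n u u
| reach_step n u w v : reach e n u w -> e w v -> reach e n.+1 u v.

Lemma reach_leq e n p u v : (n <= p)%N -> reach e n u v -> reach e p u v.
Proof.
move=> + uv; elim: uv p => {n u v} [n u p _|n u w v uw IH wv [//|p]].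
  exact: reach_refl.
by rewrite ltnS => np; apply: reach_step wv; exact: IH.
Qed.

Lemma reach_trans e n p u v w :
  reach e n u v -> reach e p v w -> reach e (n + p) u w.
Proof.
move=> uv vw; elim: vw uv => {p v w} [p v uv|p v x w vx IH xw uv].
  by apply: reach_leq uv; exact: leq_addr.
by rewrite addnS; apply: reach_step xw; exact: IH.
Qed.

Lemma reach_sym e n u v :
  (forall x y, e x y -> e y x) -> reach e n u v -> reach e n v u.
Proof.
move=> sym_e; elim=> {n u v} [n u|n u w v _ IH wv]; first exact: reach_refl.
rewrite -addn1 addnC; apply: reach_trans IH.
by apply: reach_step (sym_e _ _ wv); exact: reach_refl.
Qed.

Lemma reach_mono e e' n u v :
  (forall x y, e x y -> e' x y) -> reach e n u v -> reach e' n u v.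
Proof.
move=> ee'; elim=> {n u v} [n u|n u w v _ IH wv]; first exact: reach_refl.
exact: reach_step IH (ee' _ _ wv).
Qed.

Lemma reach_path e n u v : reach e n u v ->
  exists s : seq T, [/\ path (fun x y => `[< e x y >]) u s, last u s = v
                      & (size s <= n)%N].
Proof.
elim=> {n u v} [n u|n u w v _ [s [us sw sn]] wv]; first by exists [::].
exists (rcons s v); rewrite rcons_path us sw last_rcons size_rcons; split=> //.
exact/asboolP.
Qed.

End Walks.

(** * Linear functionals and the ratio test *)

Section Dot.
Context {R : realType} {m : nat}.
Implicit Types (c u v : 'rV[R]_m).

Lemma dotDr c u v : dot c (u + v) = dot c u + dot c v.
Proof. by rewrite -big_split; apply: eq_bigr => j _; rewrite mxE mulrDr. Qed.

Lemma dotZr c t u : dot c (t *: u) = t * dot c u.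
Proof. by rewrite /dot mulr_sumr; apply: eq_bigr => j _; rewrite mxE mulrCA. Qed.

Lemma dot0r c : dot c 0 = 0.
Proof. by rewrite -[X in dot c X](scale0r 0) dotZr mul0r. Qed.

Lemma dotNr c u : dot c (- u) = - dot c u.
Proof. by rewrite -scaleN1r dotZr mulN1r. Qed.

Lemma dotBr c u v : dot c (u - v) = dot c u - dot c v.
Proof. by rewrite dotDr dotNr. Qed.

Lemma dot_sumr c (J : finType) (P : pred J) (F : J -> 'rV[R]_m) :
  dot c (\sum_(i | P i) F i) = \sum_(i | P i) dot c (F i).
Proof. by elim/big_rec2: _ => [|i x y _ <-]; rewrite ?dot0r ?dotDr. Qed.

Lemma dot_suml (J : finType) (P : pred J) (F : J -> 'rV[R]_m) u :
  dot (\sum_(i | P i) F i) u = \sum_(i | P i) dot (F i) u.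
Proof.
elim/big_rec2: _ => [|i x y _ <-].
  by rewrite /dot big1 // => j _; rewrite mxE mul0r.
by rewrite /dot -big_split; apply: eq_bigr => j _; rewrite mxE mulrDl.
Qed.

Lemma dot_mulmx c u : u *m c^T = (dot c u)%:M.
Proof.
by apply/matrixP=> i j; rewrite !ord1 !mxE mulr1n; apply: eq_bigr => k _;
  rewrite mxE mulrC.
Qed.

(** The direction of the hyperplane section of an affine space with direction
    [W] by a level set of [c]. *)
Definition orth (W : 'M[R]_m) c : 'M[R]_m := (W :&: kermx c^T)%MS.

Lemma orthP W c u :
  reflect ((u <= W)%MS /\ dot c u = 0) (u <= orth W c)%MS.
Proof.
rewrite sub_capmx; apply: (iffP andP) => -[uW].
  by move/sub_kermxP; rewrite dot_mulmx => /matrixP/(_ 0 0); rewrite !mxE.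
move=> cu; split=> //; apply/sub_kermxP; rewrite dot_mulmx cu.
by apply/matrixP => i j; rewrite !mxE mul0rn.
Qed.

(** Dimension drops by exactly one when passing to a face whose constraint is
    not constant on the affine space. *)
Lemma rank_orth W c u : (u <= W)%MS -> dot c u != 0 ->
  \rank W = (\rank (orth W c)).+1.
Proof.
move=> uW cu; suff r1 : \rank (W *m c^T) = 1%N.
  by have := mxrank_mul_ker W c^T; rewrite r1 add1n => ->.
apply/eqP; rewrite eqn_leq rank_leq_col lt0n mxrank_eq0.
apply: contra cu => /eqP Wc0; have := submxMr c^T uW.
rewrite Wc0 dot_mulmx => /submx0null/matrixP/(_ 0 0).
by rewrite !mxE mulr1n => /eqP.
Qed.

End Dot.

(** The pivoting rule of the simplex method: moving along a direction consumes
    the slack [s j] of constraint [j] at speed [r j], and the constraint with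
    the least quotient among those of positive speed is the first to block. *)
Lemma ratio_test (R : realFieldType) (J : finType) (S : pred J) (s r : J -> R) :
    (forall j, S j -> 0 <= s j) -> (exists2 i, S i & 0 < r i) ->
  exists i, [/\ S i, 0 < r i & forall j, S j -> s i / r i * r j <= s j].
Proof.
move=> s0 [i0 Si0 ri0]; pose Q j := S j && (0 < r j).
have Qi0 : Q i0 by rewrite /Q Si0.
have [i /andP[Si ri] imin] := @arg_minP _ _ _ i0 Q (fun i => s i / r i) Qi0.
exists i; split=> // j Sj; have [rj|rj] := ltP 0 (r j).
  by rewrite -ler_pdivlMr//; apply: imin; rewrite /Q Sj.
by apply: (@le_trans _ _ 0); rewrite ?s0// mulr_ge0_le0// divr_ge0 ?s0// ltW.
Qed.

(** * Vertices and edges of a system of inequalities *)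

Section Systems.
Context {R : realType} {m N : nat} (a : 'I_N -> 'rV[R]_m) (b : 'I_N -> R).
Implicit Types (I B : {set 'I_N}) (W : 'M[R]_m) (x u v w r z : 'rV[R]_m).

(** The polyhedron of the affine space through [x0] with direction [W] cut out by
    the constraints of [I].  Faces and relaxations of one polyhedron are then
    described over the same ambient data [a] and [b], by changing [I], [W] and
    [x0] only. *)
Definition feasible I W (x0 : 'rV[R]_m) x :=
  (x - x0 <= W)%MS /\ forall i, i \in I -> dot (a i) x <= b i.

Definition tight I x : {set 'I_N} := [set i in I | dot (a i) x == b i]%SET.

Lemma tightP I x i : reflect (i \in I /\ dot (a i) x = b i) (i \in tight I x).
Proof. by rewrite inE; apply: (iffP andP) => -[iI /eqP]. Qed.

(** Vertices and edges are defined by the rank of their tight constraints rather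
    than by supporting hyperplanes; [vertexP] and [adjacent_edge] make the link
    with the geometric notions.  This reading makes sense for redundant and
    degenerate systems, such as those of faces and relaxations. *)
Definition vertex I W x0 x := feasible I W x0 x /\
  forall z, (z <= W)%MS -> (forall i, i \in tight I x -> dot (a i) z = 0) ->
    z = 0.

Definition adjacent I W x0 u v :=
  [/\ vertex I W x0 u, vertex I W x0 v, u <> v
    & forall z, (z <= W)%MS ->
        (forall i, i \in tight I u -> i \in tight I v -> dot (a i) z = 0) ->
        exists t, z = t *: (v - u)].

(** The directions of the edges, bounded or not, that leave [x]: the extreme rays
    of the cone of feasible directions. *)
Definition edge_direction I W x r :=
  [/\ (r <= W)%MS, forall i, i \in tight I x -> dot (a i) r <= 0
    & forall z, (z <= W)%MS ->
        (forall i, i \in tight I x -> dot (a i) r = 0 -> dot (a i) z = 0) ->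
        exists t, z = t *: r].

Lemma adjacent_sym I W x0 u v : adjacent I W x0 u v -> adjacent I W x0 v u.
Proof.
move=> [Vu Vv uv H]; split=> // [/esym//|z zW Hz].
have [i iu iv|t ->] := H z zW; first exact: Hz.
by exists (- t); rewrite scaleNr -scalerN opprB.
Qed.

Lemma feasible_sub I W x0 u v :
  feasible I W x0 u -> feasible I W x0 v -> (v - u <= W)%MS.
Proof.
move=> [uW _] [vW _]; have -> : v - u = (v - x0) - (u - x0).
  by rewrite opprB addrA subrK.
by rewrite addmx_sub// eqmx_opp.
Qed.

Lemma vertex_eq I W x0 u v : vertex I W x0 u -> feasible I W x0 v ->
  tight I u \subset tight I v -> u = v.
Proof.
move=> [Fu Hu] Fv /fintype.subsetP sub; apply/eqP.
rewrite eq_sym -subr_eq0; apply/eqP; apply: Hu => [|i iu].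
  exact: feasible_sub Fu Fv.
have /tightP[_ ev] := sub i iu; have /tightP[_ eu] := iu.
by rewrite dotBr ev eu subrr.
Qed.

Lemma vertex_superset I B W x0 x : B \subset I -> tight I x \subset B ->
  vertex I W x0 x -> vertex B W x0 x.
Proof.
move=> /fintype.subsetP BI /fintype.subsetP IB [[xW xI] Hx]; split.
  by split=> // i /BI; exact: xI.
move=> z zW Hz; apply: Hx => // i ix; apply: Hz.
by have /tightP[iI e] := ix; apply/tightP; split=> //; exact: IB.
Qed.

Lemma tight_subset I B x : B \subset I -> tight B x \subset tight I x.
Proof.
move=> /fintype.subsetP BI; apply/fintype.subsetP => i /tightP[iB e].
by apply/tightP; split=> //; exact: BI.
Qed.

(** A pointed cone on which [c] takes a positive value has an extreme ray on which
    [c] is positive.  If [r0] is not extreme, its tight constraints leave room for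
    a second direction, which can be corrected by a multiple of [r0] so that [c]
    vanishes on it; moving [r0] along it keeps [c] and, the cone being pointed,
    meets a new constraint in one of the two senses.  The induction is on the
    number of constraints that are not tight at [r0]. *)
Lemma cone_ray I W (c r0 : 'rV[R]_m) :
    (forall z, (z <= W)%MS -> (forall i, i \in I -> dot (a i) z = 0) -> z = 0) ->
    (r0 <= W)%MS -> (forall i, i \in I -> dot (a i) r0 <= 0) -> 0 < dot c r0 ->
  exists r, [/\ (r <= W)%MS, forall i, i \in I -> dot (a i) r <= 0,
    0 < dot c r
    & forall z, (z <= W)%MS ->
        (forall i, i \in I -> dot (a i) r = 0 -> dot (a i) z = 0) ->
        exists t, z = t *: r].
Proof.
move=> ptd; have [n] := ubnP #|[set i in I | dot (a i) r0 != 0]%SET|.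
elim: n r0 => // n IH r0 ltn r0W r0I cr0.
pose rigid z := (forall i, i \in I -> dot (a i) r0 = 0 -> dot (a i) z = 0).
have [allz|] := pselect (forall z, (z <= W)%MS -> rigid z -> exists t, z = t *: r0).
  by exists r0.
move=> /existsNP[z /not_implyP[zW /not_implyP[rz nz]]].
have [z' [z'W rz' cz' [i1 i1I i1z']]] : exists z', [/\ (z' <= W)%MS, rigid z',
    dot c z' = 0 & exists2 i, i \in I & 0 < dot (a i) z'].
  (* This correction kills c and stays rigid, r0 being rigid itself. *)
  pose q := z - (dot c z / dot c r0) *: r0.
  have qW : (q <= W)%MS by rewrite addmx_sub// eqmx_opp scalemx_sub.
  have rq : rigid q.
    by move=> i iI i0; rewrite dotBr dotZr rz// i0 mulr0 subrr.
  have cq : dot c q = 0 by rewrite dotBr dotZr divfK ?subrr// gt_eqF.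
  have /existsNP[i /not_implyP[iI /eqP]] :
      ~ forall i, i \in I -> dot (a i) q = 0.
    move=> /(ptd _ qW)/eqP; rewrite subr_eq0 => /eqP zq.
    by apply: nz; exists (dot c z / dot c r0).
  rewrite neq_lt => /orP[qi|qi]; last by exists q; split=> //; exists i.
  exists (- q); rewrite eqmx_opp; split=> //.
  - by move=> j jI j0; rewrite dotNr rq ?oppr0.
  - by rewrite dotNr cq oppr0.
  - by exists i; rewrite // dotNr oppr_gt0.
have [||i [iI ri it]] := @ratio_test R _ (mem I) (fun i => - dot (a i) r0)
    (fun i => dot (a i) z').
- by move=> j jI /=; rewrite oppr_ge0 r0I.
- by exists i1.
set t := _ / _ in it; apply: (IH (r0 + t *: z')).
- apply: leq_trans (_ : _ < _)%N (ltn : (_ <= n)%N).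
  apply: proper_card; apply/properP; split.
    apply/fintype.subsetP => j; rewrite !inE => /andP[jI]; rewrite jI /=.
    apply: contra => /eqP j0; rewrite dotDr dotZr j0 rz'//.
    by rewrite mulr0 addr0.
  exists i; rewrite !inE; move: (iI) => /= ->/=.
    by apply: contraTneq ri => i0; rewrite rz'// ltxx.
  by rewrite dotDr dotZr /t divfK ?(gt_eqF ri)//= subrr eqxx.
- by rewrite addmx_sub// scalemx_sub.
- by move=> j jI; rewrite dotDr dotZr -lerBrDl sub0r it.
- by rewrite dotDr dotZr cz' mulr0 addr0.
Qed.

(** The simplex method never gets stuck: apply [cone_ray] to the direction from
    [w] to a better point. *)
Lemma improving_edge I W x0 w y (c : 'rV[R]_m) :
    vertex I W x0 w -> feasible I W x0 y -> dot c w < dot c y ->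
  exists r, edge_direction I W w r /\ 0 < dot c r.
Proof.
move=> [Fw ptd] Fy cwy.
have [|||r [rW rI cr rE]] := @cone_ray (tight I w) W c (y - w) ptd.
- exact: feasible_sub Fw Fy.
- move=> i /tightP[iI e]; rewrite dotBr subr_le0 e.
  by case: Fy => _; apply.
- by rewrite dotBr subr_gt0.
by exists r.
Qed.

Lemma follow_edge I W x0 x r : vertex I W x0 x -> edge_direction I W x r ->
    (exists2 i, i \in I & 0 < dot (a i) r) ->
  exists t i, [/\ 0 < t, i \in tight I (x + t *: r), 0 < dot (a i) r
    & adjacent I W x0 x (x + t *: r)].
Proof.
move=> Vx [rW rI rE] [i0 i0I i0r]; have [[xW xI] ptd] := Vx.
have [||i [/= iI ri it]] := @ratio_test R _ (mem I)
    (fun i => b i - dot (a i) x) (fun i => dot (a i) r).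
- by move=> j jI /=; rewrite subr_ge0 xI.
- by exists i0.
set t := _ / _ in it.
have it0 : i \in tight I (x + t *: r).
  by apply/tightP; split=> //; rewrite dotDr dotZr /t divfK ?(gt_eqF ri)//= addrC subrK.
have keep j : j \in tight I x -> dot (a j) r = 0 -> j \in tight I (x + t *: r).
  move=> /tightP[jI e] j0; apply/tightP; split=> //.
  by rewrite dotDr dotZr j0 mulr0 addr0.
have t0 : 0 < t.
  rewrite divr_gt0// subr_gt0 lt_neqAle xI// andbT; apply/negP => /eqP e.
  have ix : i \in tight I x by apply/tightP.
  by have := rI _ ix; rewrite leNgt ri.
exists t, i; split=> //; split=> //.
- split.
    split; first by rewrite addrAC addmx_sub// scalemx_sub.
    by move=> j jI; rewrite dotDr dotZr -lerBrDl it.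
  move=> z zW Hz; have [|s zE] := rE z zW; first by move=> j jx j0; exact/Hz/keep.
  have := Hz i it0; rewrite zE dotZr => /eqP; rewrite mulf_eq0 (gt_eqF ri) orbF.
  by move=> /eqP->; rewrite scale0r.
- move=> /eqP; rewrite eq_sym -subr_eq0 addrAC subrr add0r scaler_eq0 gt_eqF//=.
  by move=> /eqP r0; move: ri; rewrite r0 dot0r ltxx.
- move=> z zW Hz; have [|s ->] := rE z zW.
    by move=> j jx j0; apply: Hz => //; exact: keep.
  exists (s / t); rewrite addrAC subrr add0r scalerA divfK// gt_eqF//.
Qed.

(** There are finitely many vertices, a vertex being determined by its set of tight
    constraints, so [c] has a maximum over them even if it is unbounded on the
    polyhedron. *)
Lemma exists_max_vertex I W x0 u (c : 'rV[R]_m) : vertex I W x0 u ->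
  exists2 w, vertex I W x0 w &
    forall x, vertex I W x0 x -> dot c x <= dot c w.
Proof.
move=> Vu.
pose pick (S : {set 'I_N}) := xget u (fun x => vertex I W x0 x /\ tight I x = S).
have Vpick S : vertex I W x0 (pick S).
  by rewrite /pick; case: xgetP => [x _ []|].
have pickE x : vertex I W x0 x -> pick (tight I x) = x.
  move=> Vx; rewrite /pick; case: xgetP => [y _ [Vy e]|/(_ x)]; last first.
    by move=> /not_andP[].
  by apply: vertex_eq Vy (Vx.1) _; rewrite e.
have [S _ Smax] := @arg_maxP _ _ _ finset.set0 predT (fun S => dot c (pick S)) isT.
exists (pick S) => // x Vx.
by rewrite -{1}(pickE x Vx); exact: Smax.
Qed.

Lemma vertex_tight_rank I W x0 x : vertex I W x0 x -> (\rank W <= #|tight I x|)%N.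
Proof.
move=> [_ ptd]; pose A := \matrix_(j < m, k < #|tight I x|) a (enum_val k) 0 j.
suff K0 : \rank (W :&: kermx A) = 0%N.
  by rewrite -(mxrank_mul_ker W A) K0 addn0; exact: rank_leq_col.
apply/eqP; rewrite mxrank_eq0 -submx0; apply/row_subP => k.
set z := row k _; have : (z <= W :&: kermx A)%MS by exact: row_sub.
rewrite sub_capmx => /andP[zW /sub_kermxP zA].
suff -> : z = 0 by rewrite sub0mx.
apply: ptd => // i ix.
have /matrixP/(_ 0 (enum_rank_in ix i)) := zA; rewrite !mxE => <-.
by apply: eq_bigr => j _; rewrite [A _ _]mxE enum_rankK_in// mulrC.
Qed.

End Systems.

(** * The Kalai--Kleitman recursion *)

Section KalaiKleitman.
Context {R : realType} {m N : nat} (a : 'I_N -> 'rV[R]_m) (b : 'I_N -> R).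
Implicit Types (I B : {set 'I_N}) (W : 'M[R]_m) (u v w x y z : 'rV[R]_m).
Local Notation feasible := (feasible a b).
Local Notation vertex := (vertex a b).
Local Notation adjacent := (adjacent a b).
Local Notation tight := (tight a b).

Lemma reach_vertex I W x0 n u x :
  vertex I W x0 u -> reach (adjacent I W x0) n u x -> vertex I W x0 x.
Proof. by move=> + ux; elim: ux => // {}n {}u w {}x _ _ [_ ? _ _]. Qed.

(** Dropping the constraints outside [B] does not open shortcuts from [u]: the
    first edge of a walk in the relaxation that leaves the polyhedron would cross
    a dropped constraint at a vertex within distance [f] of [u], whose tight
    constraints are all in [B]. *)
Lemma relaxation_walk I B W x0 f u s w :
    B \subset I -> vertex I W x0 u ->
    (forall x, reach (adjacent I W x0) f u x -> tight I x \subset B) ->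
    reach (adjacent B W x0) s u w -> (s <= f)%N ->
  reach (adjacent I W x0) s u w.
Proof.
move=> BI Vu fB uw; elim: uw Vu fB => {s u w} [s u|s u p q _ IH pq] Vu fB sf.
  exact: reach_refl.
have {IH} up : reach (adjacent I W x0) s u p by apply: IH => //; exact: ltnW.
apply: reach_step (up) _.
have Vp := reach_vertex Vu up; have [[pW pI] _] := Vp.
have /fintype.subsetP pB := fB _ (reach_leq (ltnW sf) up).
have tBI x : {subset tight B x <= tight I x}.
  by apply/fintype.subsetP; exact: tight_subset.
have [[Fp _] [[qW qB] ptd] npq edge] := pq.
have qpW : (q - p <= W)%MS by apply: feasible_sub Fp _; split.
have dir : edge_direction a b I W p (q - p).
  split=> // [i ip|z zW Hz].
    by have /tightP[_ e] := ip; rewrite dotBr subr_le0 e qB// pB.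
  apply: edge => // i ip iq; apply: Hz; first exact: tBI.
  have /tightP[_ e] := ip; have /tightP[_ e'] := iq.
  by rewrite dotBr e e' subrr.
have [qI|/existsNP[i /not_implyP[iI /negP]]] :=
  pselect (forall i, i \in I -> dot (a i) q <= b i).
  split=> //; last first.
    by move=> z zW Hz; apply: edge => // i ip iq; apply: Hz; exact: tBI.
  split; first by split.
  by move=> z zW Hz; apply: ptd => // i iq; apply: Hz; exact: tBI.
rewrite -ltNge => biq; exfalso.
have [|t [j [t0 jx jr px]]] := follow_edge Vp dir.
  by exists i => //; rewrite dotBr subr_gt0; exact: le_lt_trans (pI i iI) biq.
have Bj : j \in B.
  have /fintype.subsetP := fB _ (reach_leq sf (reach_step up px)).
  exact.
have := qB j Bj; have /tightP[_ <-] := jx.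
have [_ [[_ xI] _] _ _] := px; have := le_lt_trans (xI i iI) biq.
have := pI i iI; move: jr; rewrite !(dotBr, dotDr, dotZr).
by nra.
Qed.

Definition touched I W x0 f u : {set 'I_N} :=
  [set i in I | `[< exists x, reach (adjacent I W x0) f u x /\ i \in tight I x >]]%SET.

Lemma touchedP I W x0 f u i :
  reflect (exists x, reach (adjacent I W x0) f u x /\ i \in tight I x)
          (i \in touched I W x0 f u).
Proof.
rewrite inE; apply: (iffP andP) => [[_ /asboolP]//|[x [ux ix]]]; split.
  by have /tightP[] := ix.
by apply/asboolP; exists x.
Qed.

Lemma touched_subset I W x0 f u : touched I W x0 f u \subset I.
Proof. by apply/fintype.subsetP => i; rewrite inE => /andP[]. Qed.

Lemma reach_touched I W x0 f u x : reach (adjacent I W x0) f u x ->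
  tight I x \subset touched I W x0 f u.
Proof. by move=> ux; apply/fintype.subsetP => i ix; apply/touchedP; exists x. Qed.

(** The key step of the Kalai--Kleitman argument.  Suppose that the constraints
    [B] touched within distance [f + 1] define a relaxation all of whose vertices
    are within [f] of [u].  By [relaxation_walk] they are vertices of the
    polyhedron itself.  If [v] had a tight constraint [i] outside [B], take a
    vertex [w] of the relaxation that is highest for [a i].  It lies
    below the level of [v], or else [i] would be touched at [w], so an edge
    improves on it; following this edge in the polyhedron
    ends at a vertex within [f + 1] of [u], hence a vertex of the relaxation,
    higher than [w].  So [v] is a vertex of the relaxation too.  In particular the
    connectedness of the graph comes out of the argument. *)
Lemma few_touched I W x0 f u v (B := touched I W x0 f.+1 u) :
    vertex I W x0 u -> vertex I W x0 v ->
    (forall w, vertex B W x0 w -> reach (adjacent B W x0) f u w) ->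
  reach (adjacent I W x0) f u v.
Proof.
move=> Vu Vv Bf; have BI : B \subset I := touched_subset _ _ _ _ _.
have lifted w : vertex B W x0 w -> reach (adjacent I W x0) f u w.
  move=> Vw; apply: relaxation_walk BI Vu _ (Bf w Vw) (leqnn f) => x ux.
  exact/reach_touched/(reach_leq (leqnSn f)).
have VB x : vertex I W x0 x -> reach (adjacent I W x0) f.+1 u x -> vertex B W x0 x.
  by move=> Vx ux; apply: vertex_superset (BI) _ Vx; exact: reach_touched.
apply: (lifted); apply: vertex_superset (BI) _ (Vv); apply/fintype.subsetP => i iv.
have /tightP[iI ei] := iv; apply/negPn/negP => iB.
have VBu : vertex B W x0 u by apply: VB => //; exact: reach_refl.
have [w Vw wmax] := exists_max_vertex (a i) VBu.
have uw := lifted w Vw; have uw' := reach_leq (leqnSn f) uw.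
have VIw := reach_vertex Vu uw; have [[wW wI] _] := VIw.
have Fv : feasible B W x0 v.
  by have [[vW vI] _] := Vv; split=> // j jB; apply: vI; exact: fintype.subsetP BI j jB.
have wv : dot (a i) w < dot (a i) v.
  rewrite ei lt_neqAle wI// andbT; apply: contra iB => /eqP e.
  by apply/touchedP; exists w; split=> //; apply/tightP.
have [r [[rW rI rE] ir]] := improving_edge Vw Fv wv.
have wB : {subset tight I w <= tight B w}.
  move=> j jw; have /tightP[_ e] := jw; apply/tightP; split=> //.
  by have /fintype.subsetP := reach_touched uw'; exact.
have dir : edge_direction a b I W w r.
  split=> // [j /wB|z zW Hz]; first exact: rI.
  apply: rE => // j jw; apply: Hz.
  by have /fintype.subsetP := tight_subset a b w BI; exact.
have [|t [j [t0 jx jr wx]]] := follow_edge VIw dir; first by exists i.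
have ux := reach_step uw wx.
have := wmax _ (VB _ (reach_vertex Vu ux) ux).
by rewrite dotDr dotZr gerDl leNgt mulr_gt0.
Qed.

(** A vertex of the polyhedron on the constraint [i] is a vertex of the face where
    [i] is tight, described by moving [i] from the inequalities into the
    direction space; conversely walks in the face are walks in the polyhedron. *)
Lemma face_vertex I W x0 i u x : i \in I -> vertex I W x0 u ->
    i \in tight I u -> i \in tight I x ->
  vertex I W x0 x -> vertex (I :\ i) (orth W (a i)) u x.
Proof.
move=> iI [Fu _] iu ix [Fx ptd]; split.
  split; last by move=> j /setD1P[_ jI]; exact: Fx.2.
  apply/orthP; split; first exact: feasible_sub Fu Fx.
  have /tightP[_ e] := iu; have /tightP[_ e'] := ix.
  by rewrite dotBr e e' subrr.
move=> z /orthP[zW iz] Hz; apply: ptd => // j jx.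
have [->//|ji] := eqVneq j i; apply: Hz; have /tightP[jI e] := jx.
by apply/tightP; rewrite in_setD1 ji.
Qed.

Lemma face_vertexW I W x0 i u x : i \in I -> vertex I W x0 u ->
    i \in tight I u -> vertex (I :\ i) (orth W (a i)) u x ->
  vertex I W x0 x /\ i \in tight I x.
Proof.
move=> iI [[uW uI] _] /tightP[_ iu] [[/orthP[xW ix] xI] ptd].
have it : i \in tight I x.
  by apply/tightP; split=> //; apply/eqP; rewrite -iu -subr_eq0 -dotBr ix.
split=> //; split.
  split; first by rewrite -(subrK u x) -addrA addmx_sub.
  move=> j jI; have [->|ji] := eqVneq j i; first by have /tightP[_ ->] := it.
  by apply: xI; rewrite in_setD1 ji.
move=> z zW Hz; apply: ptd; first by apply/orthP; split=> //; exact: Hz.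
move=> j /tightP[/setD1P[_ jI] e]; apply: Hz; exact/tightP.
Qed.

Lemma face_adjacent I W x0 i u x y : i \in I -> vertex I W x0 u ->
    i \in tight I u -> adjacent (I :\ i) (orth W (a i)) u x y ->
  adjacent I W x0 x y.
Proof.
move=> iI Vu iu [Vx Vy xy edge].
have [Vx' ix] := face_vertexW iI Vu iu Vx.
have [Vy' iy] := face_vertexW iI Vu iu Vy.
split=> // z zW Hz; apply: edge; first by apply/orthP; split=> //; exact: Hz.
move=> j /tightP[/setD1P[_ jI] e] /tightP[_ e']; apply: Hz; exact/tightP.
Qed.

(** A constraint that is constant on the affine space can be dropped; such
    constraints appear when one passes to a face. *)
Lemma constant_feasible I W x0 i x : i \in I ->
    (forall z, (z <= W)%MS -> dot (a i) z = 0) -> (exists u, feasible I W x0 u) ->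
  feasible (I :\ i) W x0 x <-> feasible I W x0 x.
Proof.
move=> iI i0 [u [uW uI]]; split=> -[xW xI]; split=> // j.
  move=> jI; have [->|ji] := eqVneq j i; last by apply: xI; rewrite in_setD1 ji.
  have -> : x = u + ((x - x0) - (u - x0)).
    by rewrite addrC opprB addrA !subrK.
  by rewrite dotDr [X in _ + X]i0 ?addr0 ?uI// addmx_sub// eqmx_opp.
by move=> /setD1P[_ jI]; exact: xI.
Qed.

Lemma constant_vertex I W x0 i x : i \in I ->
    (forall z, (z <= W)%MS -> dot (a i) z = 0) -> (exists u, feasible I W x0 u) ->
  vertex (I :\ i) W x0 x <-> vertex I W x0 x.
Proof.
move=> iI i0 exu; split=> -[Fx ptd]; split.
- exact/(constant_feasible _ iI i0 exu).
- move=> z zW Hz; apply: ptd => // j /tightP[/setD1P[_ jI] e].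
  by apply: Hz; apply/tightP.
- exact/(constant_feasible _ iI i0 exu).
- move=> z zW Hz; apply: ptd => // j /tightP[jI e].
  have [->|ji] := eqVneq j i; first exact: i0.
  by apply: Hz; apply/tightP; rewrite in_setD1 ji.
Qed.

Lemma constant_adjacent I W x0 i x y : i \in I ->
    (forall z, (z <= W)%MS -> dot (a i) z = 0) -> (exists u, feasible I W x0 u) ->
  adjacent (I :\ i) W x0 x y -> adjacent I W x0 x y.
Proof.
move=> iI i0 exu [/(constant_vertex _ iI i0 exu) Vx].
move=> /(constant_vertex _ iI i0 exu) Vy xy edge; split=> // z zW Hz.
apply: edge => // j /tightP[/setD1P[_ jI] e] /tightP[_ e'].
by apply: Hz; apply/tightP.
Qed.

(** The solution of the recursion in the dimension [d], for a given excess [k] of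
    the number of constraints over [d]: stage [j] costs two walks in systems of
    excess [(k - j) / 2] and two more steps if [j <= k], and nothing if [j > k].
    The index of the sum is [i = k - j]. *)
Definition staged (G : nat -> nat) d k :=
  (\sum_(k - d <= i < k) (2 * G i./2 + 2))%N.

Lemma staged_le G d k :
  (forall k, \sum_(i < k) (2 * G i./2 + 2) <= G k)%N -> (staged G d k <= G k)%N.
Proof.
move=> HG; apply: leq_trans (HG k).
rewrite -(big_mkord xpredT (fun i => 2 * G i./2 + 2)%N).
by rewrite (big_cat_nat (n := k - d)) ?leq_subr//= leq_addl.
Qed.

Lemma stagedS G d k : staged G d.+1 k =
  (staged G d k + if (d < k)%N then 2 * G ((k - d.+1)./2) + 2 else 0)%N.
Proof.
rewrite /staged; case: ltnP => dk; last first.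
  have -> : (k - d.+1 = 0)%N by lia.
  have -> : (k - d = 0)%N by lia.
  by rewrite addn0.
rewrite big_ltn; last by lia.
have -> : ((k - d.+1).+1 = k - d)%N by lia.
by rewrite addnC.
Qed.

(** Induction on the number of constraints.  Let [d + 1] be the dimension and [k]
    the excess.  If the constraints touched by short walks from [u] and from [v]
    both exceed half of all constraints, they share one, and it remains to join
    two vertices of the corresponding face, of dimension [d] and the same excess.
    For [k <= d] the
    radius 0 is enough, since a vertex has at least [d + 1] tight constraints.
    For [d < k] take the radius [G ((k - (d + 1)) / 2) + 1]: if it touches at most
    half of the constraints, these define a system of dimension [d + 1] and excess
    at most [(k - (d + 1)) / 2], and [few_touched] applies. *)
Theorem system_diameter G :
    (forall k, \sum_(i < k) (2 * G i./2 + 2) <= G k)%N ->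
  forall I W x0 k u v, (#|I| <= \rank W + k)%N ->
    vertex I W x0 u -> vertex I W x0 v ->
  reach (adjacent I W x0) (staged G (\rank W) k) u v.
Proof.
move=> HG I; have [n] := ubnP #|I|; elim: n I => // n IH I In W x0 k u v Ik Vu Vv.
have IHD i : i \in I -> (#|I :\ i| < n)%N.
  by move=> iI; move: In; rewrite (cardsD1 i) iI.
have [[i iI i0]|noconst] :=
  pselect (exists2 i, i \in I & forall z, (z <= W)%MS -> dot (a i) z = 0).
  have exu : exists u, feasible I W x0 u by exists u; case: Vu.
  apply: reach_mono (fun x y => constant_adjacent iI i0 exu) _.
  apply: IH (IHD i iI) _ _ _ _ _ _ _ _; last 2 first.
  - exact/constant_vertex.
  - exact/constant_vertex.
  - by apply: leq_trans Ik; rewrite subset_leq_card// subD1set.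
case dE : (\rank W) => [|d].
  have -> : u = v; last exact: reach_refl.
  move/eqP: dE; rewrite mxrank_eq0 => /eqP W0.
  have [[uW _] _] := Vu; have [[vW _] _] := Vv.
  move: uW vW; rewrite W0 => /submx0null/eqP + /submx0null/eqP.
  by rewrite !subr_eq0 => /eqP-> /eqP->.
pose f := if (d < k)%N then (G ((k - d.+1)./2)).+1 else 0%N.
have stE : staged G d.+1 k = (f + staged G d k + f)%N.
  by rewrite stagedS /f; case: ifP => _; lia.
have big w w' : vertex I W x0 w -> vertex I W x0 w' ->
    (2 * #|touched I W x0 f w| <= #|I|)%N ->
  reach (adjacent I W x0) (staged G d.+1 k) w w'.
  move=> Vw Vw' small.
  have dtouched : (d < #|touched I W x0 f w|)%N.
    rewrite -dE; apply: leq_trans (vertex_tight_rank Vw) _.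
    exact/subset_leq_card/reach_touched/reach_refl.
  have dk : (d < k)%N by move: Ik; rewrite dE; lia.
  have fE : f = (G ((k - d.+1)./2)).+1 by rewrite /f dk.
  apply: (@reach_leq _ _ (G ((k - d.+1)./2))); first by rewrite stE fE; lia.
  apply: few_touched => // x Vx; rewrite -fE in Vx *.
  apply: (@reach_leq _ _ (staged G (\rank W) ((k - d.+1)./2))).
    exact: staged_le.
  apply: IH => //; last first.
  - apply: vertex_superset (Vw); first exact: touched_subset.
    exact/reach_touched/reach_refl.
  - by move: Ik; rewrite dE; lia.
  - by move: In; lia.
have [/(big u v Vu Vv)//|ubig] := leqP (2 * #|touched I W x0 f u|) #|I|.
have [/(big v u Vv Vu)|vbig] := leqP (2 * #|touched I W x0 f v|) #|I|.
  by apply: reach_sym => ? ?; exact: adjacent_sym.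
have [i iuv] : exists i, i \in touched I W x0 f u :&: touched I W x0 f v.
  apply/set0Pn; rewrite -card_gt0.
  have := cardsUI (touched I W x0 f u) (touched I W x0 f v).
  have : (#|touched I W x0 f u :|: touched I W x0 f v| <= #|I|)%N.
    by apply: subset_leq_card; rewrite finset.subUset !touched_subset.
  by lia.
move: iuv; rewrite finset.in_setI => /andP[/touchedP[x [ux ix]] /touchedP[y [vy iy]]].
have iI : i \in I by have /tightP[] := ix.
have Vx := reach_vertex Vu ux; have Vy := reach_vertex Vv vy.
have [z zW iz] : exists2 z, (z <= W)%MS & dot (a i) z != 0.
  apply: contrapT => nz; apply: noconst; exists i => // z zW; apply: contrapT.
  by move=> /eqP iz; apply: nz; exists z.
have rW := rank_orth zW iz; have rd : \rank (orth W (a i)) = d.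
  by move: rW; rewrite dE => -[].
rewrite stE; apply: reach_trans (reach_sym (@adjacent_sym _ _ _ _ _ _ _ _) vy).
apply: reach_trans ux _.
apply: reach_mono (fun p q => face_adjacent iI Vx ix) _; rewrite -rd.
apply: IH; first exact: IHD.
- by move: Ik; rewrite dE rd (cardsD1 i) iI add1n addSn ltnS.
- exact: (face_vertex iI Vx ix ix Vx).
- exact: (face_vertex iI Vx ix iy Vy).
Qed.

End KalaiKleitman.

(** * Faces of a polyhedron in terms of tight constraints *)

Section FaceStructure.
Context {R : realType} {m N : nat} (a : 'I_N -> 'rV[R]_m) (b : 'I_N -> R).
Implicit Types (I : {set 'I_N}) (W : 'M[R]_m) (u v w x y z : 'rV[R]_m).
Local Notation feasible := (feasible a b).
Local Notation vertex := (vertex a b).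
Local Notation adjacent := (adjacent a b).
Local Notation tight := (tight a b).

(** The constraints that are not tight at [x] leave room for a small step. *)
Lemma feasible_step I W x0 x z : feasible I W x0 x -> (z <= W)%MS ->
    (forall i, i \in tight I x -> dot (a i) z <= 0) ->
  exists2 t, 0 < t & feasible I W x0 (x + t *: z).
Proof.
move=> [xW xI] zW tz.
have inW t : (x + t *: z - x0 <= W)%MS.
  by rewrite addrAC addmx_sub// scalemx_sub.
have [ex|nex] := pselect (exists2 i, i \in I & 0 < dot (a i) z); last first.
  exists 1 => //; split=> // i iI; rewrite dotDr dotZr mul1r.
  apply: le_trans (xI i iI); rewrite gerDl leNgt.
  by apply/negP => iz; apply: nex; exists i.
have [|i [/= iI iz it]] := @ratio_test R _ (mem I)
    (fun i => b i - dot (a i) x) (fun i => dot (a i) z) _ ex.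
  by move=> j jI /=; rewrite subr_ge0 xI.
exists ((b i - dot (a i) x) / dot (a i) z).
  rewrite divr_gt0// subr_gt0 lt_neqAle xI// andbT; apply/negP => /eqP e.
  have it' : i \in tight I x by apply/tightP.
  by have := tz i it'; rewrite leNgt iz.
by split=> // j jI; rewrite dotDr dotZr -lerBrDl it.
Qed.

(** The sum of the constraints of [S] supports the polyhedron, along the face where
    they are all tight: this gives the supporting hyperplanes of vertices and
    edges. *)
Lemma sum_tight_le I W x0 x (S : {set 'I_N}) : S \subset I -> feasible I W x0 x ->
  dot (\sum_(i in S) a i) x <= \sum_(i in S) b i.
Proof.
move=> /fintype.subsetP SI [_ xI]; rewrite dot_suml.
by apply: ler_sum => i /SI; exact: xI.
Qed.

Lemma sum_tight_eq I W x0 x (S : {set 'I_N}) : S \subset I -> feasible I W x0 x ->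
  dot (\sum_(i in S) a i) x = \sum_(i in S) b i -> S \subset tight I x.
Proof.
move=> /fintype.subsetP SI [_ xI]; rewrite dot_suml => /eqP.
rewrite eq_sym -subr_eq0 -sumrB psumr_eq0; last first.
  by move=> i /SI iI; rewrite subr_ge0 xI.
move=> /allP H; apply/fintype.subsetP => i iS; apply/tightP; split; first exact: SI.
have := H i (mem_index_enum i); rewrite iS /= subr_eq0 eq_sym => /eqP ->//.
Qed.

Lemma tight_sum_eq I x (S : {set 'I_N}) : S \subset tight I x ->
  dot (\sum_(i in S) a i) x = \sum_(i in S) b i.
Proof.
move=> /fintype.subsetP St; rewrite dot_suml; apply: eq_bigr => i /St.
by move=> /tightP[].
Qed.

(** A direction that kills the tight constraints can be followed a little in both
    senses, so a hyperplane that supports the polyhedron only at [v] forces it to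
    vanish. *)
Lemma vertexP I W x0 (P := [set x | feasible I W x0 x]) v :
  is_vertex P v <-> vertex I W x0 v.
Proof.
split=> [[c [be [Pc vE]]]|[Fv ptd]].
  have : (P `&` [set x | dot c x = be]) v by rewrite -vE.
  move=> -[Fv cv]; split=> // z zW tz.
  have [|t t0 Ft] := @feasible_step I W x0 v z Fv zW.
    by move=> i /tz->.
  have [||s s0 Fs] := @feasible_step I W x0 v (- z) Fv.
  - by rewrite eqmx_opp.
  - by move=> i /tz; rewrite dotNr => ->; rewrite oppr0.
  have cz : dot c z = 0.
    apply/eqP; rewrite eq_le; have := Pc _ Ft; have := Pc _ Fs.
    rewrite !dotDr !dotZr dotNr cv mulrN !gerDl oppr_le0 => cs ct.
    by rewrite -(pmulr_rle0 _ t0) -(pmulr_rge0 _ s0) cs ct.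
  have : [set v] (v + t *: z).
    by rewrite vE; split=> //=; rewrite dotDr dotZr cz mulr0 addr0.
  move=> /= /eqP; rewrite -subr_eq0 addrAC subrr add0r scaler_eq0 gt_eqF//=.
  by move/eqP.
have tI : tight I v \subset I by apply/fintype.subsetP => i /tightP[].
exists (\sum_(i in tight I v) a i), (\sum_(i in tight I v) b i); split.
  by move=> x Px; exact: sum_tight_le Px.
apply/seteqP; split=> [x ->|x [Px /(sum_tight_eq tI Px) vx]] /=.
  by split=> //=; exact: tight_sum_eq (fintype.subxx _).
by apply/esym; apply: (vertex_eq _ Px vx); split.
Qed.

Lemma affine_hull_dim (S : set 'rV[R]_m) x0 W :
  affine_hull S = [set x | (x - x0 <= W)%MS] -> has_dim S (\rank W).
Proof.
move=> SW; exists x0, (row_base W); split; first exact: row_base_free.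
by rewrite SW; apply/seteqP; split=> x /=; rewrite eq_row_base.
Qed.

Lemma affine_hull2 (S : set 'rV[R]_m) u v t : S u -> S v ->
  affine_hull S (u + t *: (v - u)).
Proof.
move=> Su Sv; pose f (i : 'I_2) A (x y : A) := if i == 0 then x else y.
exists 2%N, (fun i => f i _ u v), (fun i => f i _ (1 - t) t).
split; first by move=> i; rewrite /f; case: ifP.
  by rewrite !big_ord_recl big_ord0 /f/= addr0 subrK.
by rewrite !big_ord_recl big_ord0 /f/= addr0 scalerBr scalerBl scale1r addrAC addrA.
Qed.

Lemma affine_hull_sub p (S : set 'rV[R]_m) x0 (W : 'M[R]_(p, m)) :
  (forall x, S x -> (x - x0 <= W)%MS) ->
  forall x, affine_hull S x -> (x - x0 <= W)%MS.
Proof.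
move=> SW x [k [q [w [Sq w1 ->]]]].
rewrite -[x0]scale1r -w1 scaler_suml -sumrB summx_sub// => i _.
by rewrite -scalerBr scalemx_sub// SW.
Qed.

Lemma affine_hull_const (S : set 'rV[R]_m) c be :
  (forall x, S x -> dot c x = be) -> forall x, affine_hull S x -> dot c x = be.
Proof.
move=> Sc x [k [p [w [Sp w1 ->]]]].
rewrite dot_sumr -[be]mul1r -w1 mulr_suml; apply: eq_bigr => i _.
by rewrite dotZr Sc.
Qed.

(** The face where the common tight constraints of [u] and [v] are tight lies on
    the line through [u] and [v], and it stops at both, where some further
    constraint becomes tight. *)
Lemma adjacent_edge I W x0 (P := [set x | feasible I W x0 x]) u v :
  adjacent I W x0 u v -> vertex_adjacent P u v.
Proof.
move=> [Vu Vv uv edge]; split; [exact/vertexP|exact/vertexP|split].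
  pose S := tight I u :&: tight I v.
  have Su : S \subset tight I u := finset.subsetIl _ _.
  have Sv : S \subset tight I v := finset.subsetIr _ _.
  have SI : S \subset I.
    by apply: fintype.subset_trans Su _; apply/fintype.subsetP => i /tightP[].
  exists (\sum_(i in S) a i), (\sum_(i in S) b i); split.
    by move=> x Px; exact: sum_tight_le Px.
  have [[uW uI] ptdu] := Vu; have [[vW vI] ptdv] := Vv.
  apply/seteqP; split=> [_ [t [/andP[t0 t1] ->]]|x [Px xS]] /=.
    split=> /=; last first.
      rewrite dotDr !dotZr (tight_sum_eq Su) (tight_sum_eq Sv).
      by rewrite -mulrDl subrK mul1r.
    split.
      have -> : (1 - t) *: u + t *: v - x0 = (u - x0) + t *: ((v - x0) - (u - x0)).
        rewrite opprB [v - x0 + _]addrA subrK scalerBl scale1r scalerBr.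
        by rewrite addrACA; apply/matrixP => i j; rewrite !mxE; ring.
      by rewrite addmx_sub// scalemx_sub// addmx_sub// eqmx_opp.
    move=> i iI; rewrite dotDr !dotZr.
    have -> : b i = (1 - t) * b i + t * b i by rewrite -mulrDl subrK mul1r.
    by rewrite lerD// ler_wpM2l ?subr_ge0// ?uI// vI.
  have /fintype.subsetP Sx := sum_tight_eq SI Px xS.
  have [||t xE] := edge (x - u).
  - exact: feasible_sub Vu.1 Px.
  - move=> i iu iv; have : i \in S by rewrite finset.in_setI iu.
    move=> /Sx /tightP[_ e]; have /tightP[_ e'] := iu.
    by rewrite dotBr e e' subrr.
  have {xE} xE : x = u + t *: (v - u) by rewrite -xE addrC subrK.
  (* A line through a vertex w cannot go on feasibly behind w if it is feasible
     ahead of it; this is used at both ends of the segment. *)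
  have pos w (z : 'rV_m) (s : R) : vertex I W x0 w -> (z <= W)%MS -> z <> 0 ->
      (forall i, i \in I -> dot (a i) (w + z) <= b i) ->
      (forall i, i \in I -> dot (a i) (w + s *: z) <= b i) -> 0 <= s.
    move=> [_ ptd] zW z0 wz wsz.
    have /existsNP[i /not_implyP[iw /eqP iz]] :
        ~ forall i, i \in tight I w -> dot (a i) z = 0 by move/(ptd _ zW).
    have /tightP[iI e] := iw; have := wz i iI; have := wsz i iI.
    rewrite !dotDr dotZr e !gerDl => sz z_le0.
    have {}iz : dot (a i) z < 0 by rewrite lt_neqAle iz.
    by rewrite -(nmulr_lle0 _ iz).
  have vuW : (v - u <= W)%MS by exact: feasible_sub Vu.1 Vv.1.
  exists t; split; last by rewrite xE scalerBr scalerBl scale1r addrAC addrA.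
  apply/andP; split.
    apply: (pos u (v - u)) => //.
    - by move/eqP; rewrite subr_eq0 => /eqP/esym.
    - by move=> i iI; rewrite addrC subrK vI.
    - by move=> i iI; rewrite -xE; case: Px => _; apply.
  rewrite -subr_ge0; apply: (pos v (u - v)) => //.
  - by rewrite -opprB eqmx_opp.
  - by move/eqP; rewrite subr_eq0 => /eqP.
  - by move=> i iI; rewrite addrC subrK uI.
  - move=> i iI; have -> : v + (1 - t) *: (u - v) = x.
      by rewrite xE; apply/matrixP => k j; rewrite !mxE; ring.
    by case: Px => _; apply.
exists u, (v - u); split.
  by rewrite -row_leq_rank rank_rV subr_eq0 eq_sym; case: eqVneq uv.
apply/seteqP; split=> x /=.
  apply: affine_hull_sub => _ [t [_ ->]].
  have -> : (1 - t) *: u + t *: v - u = t *: (v - u).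
    by apply/matrixP => i j; rewrite !mxE; ring.
  exact: scalemx_sub.
move=> /sub_rVP[t xE]; have -> : x = u + t *: (v - u) by rewrite -xE addrC subrK.
apply: affine_hull2.
  by exists 0; rewrite lexx ler01 subr0 scale1r scale0r addr0.
by exists 1; rewrite lexx ler01 subrr scale1r scale0r add0r.
Qed.

End FaceStructure.

(** * Irredundant systems and facets *)

Section Irredundant.
Context {R : realType} {m N : nat} (a : 'I_N -> 'rV[R]_m) (b : 'I_N -> R).
Implicit Types (I : {set 'I_N}) (W : 'M[R]_m) (u v w x y z : 'rV[R]_m).
Local Notation feasible := (feasible a b).

Definition irredundant I W x0 := forall i, i \in I ->
  exists y, feasible (I :\ i) W x0 y /\ b i < dot (a i) y.

Lemma irredundant_subsystem I W x0 : exists2 J : {set 'I_N}, irredundant J W x0 &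
  feasible J W x0 = feasible I W x0.
Proof.
have [n] := ubnP #|I|; elim: n I => // n IH I In.
have [irr|/existsNP[i /not_implyP[iI nex]]] := pselect (irredundant I W x0).
  by exists I.
have [|J irr JE] := IH (I :\ i); first by move: In; rewrite (cardsD1 i) iI.
exists J => //; rewrite JE; apply/funext => x; apply/propext; split=> -[xW xI].
  split=> // j jI; have [->|ji] := eqVneq j i; last by rewrite xI// in_setD1 ji.
  by rewrite leNgt; apply/negP => ix; apply: nex; exists x.
by split=> // j /setD1P[_ /xI].
Qed.

(** A constraint that is tight on the whole polyhedron is tight on its affine hull
    and hence redundant, so each constraint is strict at some point; midpoints
    make all of them strict at once. *)
Lemma irredundant_interior I W x0 (P := [set x | feasible I W x0 x]) :
    irredundant I W x0 -> affine_hull P = [set x | (x - x0 <= W)%MS] ->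
    (exists x, P x) ->
  exists2 p, P p & forall i, i \in I -> dot (a i) p < b i.
Proof.
move=> irr PW [x Px].
have slack i : i \in I -> exists2 p, P p & dot (a i) p < b i.
  move=> iI; apply: contrapT => nex; have [y [[yW _] iy]] := irr i iI.
  suff : dot (a i) y = b i by move=> e; rewrite e ltxx in iy.
  apply: (@affine_hull_const _ _ P); last by rewrite PW.
  move=> q Pq; apply/eqP; rewrite eq_le Pq.2//= leNgt.
  by apply/negP => lt; apply: nex; exists q.
suff H (s : seq 'I_N) : {subset s <= I} ->
    exists2 p, P p & forall i, i \in s -> dot (a i) p < b i.
  have [|p Pp pI] := H (enum I); first by move=> i; rewrite mem_enum.
  by exists p => // i iI; apply: pI; rewrite mem_enum.
elim: s => [|i s IH] sI; first by exists x.
have [|p Pp ps] := IH; first by move=> j js; apply: sI; rewrite inE js orbT.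
have [|q Pq qi] := slack i; first by apply: sI; rewrite inE eqxx.
have mid j : dot (a j) (p + 2^-1 *: (q - p)) = (dot (a j) p + dot (a j) q) / 2.
  by rewrite dotDr dotZr dotBr; field.
exists (p + 2^-1 *: (q - p)).
  split; last first.
    by move=> j jI; rewrite mid; have := Pp.2 j jI; have := Pq.2 j jI; lra.
  by rewrite addrAC addmx_sub ?Pp.1// scalemx_sub// (feasible_sub Pp Pq).
move=> j; rewrite inE mid => /predU1P[->|js].
  have := Pp.2 i; rewrite sI ?inE ?eqxx// => /(_ isT); lra.
have := Pq.2 j; rewrite sI ?inE ?js ?orbT// => /(_ isT); have := ps j js; lra.
Qed.

Definition tight_face I W x0 i : set 'rV[R]_m :=
  [set x | feasible I W x0 x] `&` [set x | dot (a i) x = b i].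

(** Go from an interior point towards a point that violates only the constraint
    [i]: where the segment crosses [i], all the other constraints are strict. *)
Lemma tight_face_interior I W x0 p i : irredundant I W x0 -> feasible I W x0 p ->
    (forall i, i \in I -> dot (a i) p < b i) -> i \in I ->
  exists q, [/\ tight_face I W x0 i q,
    forall j, j \in I -> j != i -> dot (a j) q < b j
    & exists2 z, (z <= W)%MS & dot (a i) z != 0].
Proof.
move=> irr Fp pI iI; have [y [[yW yI] iy]] := irr i iI.
have ip := pI i iI; have ypW : (y - p <= W)%MS.
  have -> : y - p = (y - x0) - (p - x0) by rewrite opprB addrA subrK.
  by rewrite addmx_sub ?Fp.1// eqmx_opp Fp.1.
have iyp : 0 < dot (a i) (y - p) by rewrite dotBr subr_gt0 (lt_trans ip).
pose t := (b i - dot (a i) p) / dot (a i) (y - p).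
have t0 : 0 < t by rewrite divr_gt0// subr_gt0.
have t1 : t < 1 by rewrite ltr_pdivrMr// mul1r dotBr ltrD2r.
have iq : dot (a i) (p + t *: (y - p)) = b i.
  by rewrite dotDr dotZr divfK ?(gt_eqF iyp)// addrC subrK.
have qI j : j \in I -> j != i -> dot (a j) (p + t *: (y - p)) < b j.
  move=> jI ji; have := pI j jI; have := yI j; rewrite in_setD1 ji jI => /(_ isT).
  by rewrite dotDr dotZr dotBr; nra.
exists (p + t *: (y - p)); split=> //; last by exists (y - p); rewrite ?gt_eqF.
split=> //=; split; first by rewrite addrAC addmx_sub ?Fp.1// scalemx_sub.
by move=> j jI; have [->|ji] := eqVneq j i; rewrite ?iq// ltW// qI.
Qed.

Lemma tight_face_affine_hull I W x0 i q : tight_face I W x0 i q ->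
    (forall j, j \in I -> j != i -> dot (a j) q < b j) ->
  affine_hull (tight_face I W x0 i) = [set x | (x - q <= orth W (a i))%MS].
Proof.
move=> [Fq iq] qI; apply/seteqP; split=> x /=.
  apply: affine_hull_sub => y [Fy iy]; apply/orthP; split.
    exact: feasible_sub Fq Fy.
  by move: iq iy => /= iq iy; rewrite dotBr iq iy subrr.
move=> /orthP[xqW ix].
have [|t t0 Ft] := @feasible_step _ _ _ a b I W x0 q (x - q) Fq xqW.
  move=> j /tightP[jI e]; have [->|ji] := eqVneq j i; first by rewrite ix.
  by have := qI j jI ji; rewrite e ltxx.
have -> : x = q + t^-1 *: ((q + t *: (x - q)) - q).
  by rewrite addrAC subrr add0r scalerA mulVf ?gt_eqF// scale1r addrC subrK.
by apply: affine_hull2; split=> //=; rewrite dotDr dotZr ix mulr0 addr0.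
Qed.

(** The constraints of an irredundant system give distinct facets, because the
    relative interior point of the face of one of them lies on no other. *)
Lemma card_le_facets I W x0 n (P := [set x | feasible I W x0 x]) :
    irredundant I W x0 -> affine_hull P = [set x | (x - x0 <= W)%MS] ->
    (exists x, P x) -> ([set F | is_facet P F] #= `I_n)%card ->
  (#|I| <= n)%N.
Proof.
move=> irr PW Pne Pn; have [p Fp pI] := irredundant_interior irr PW Pne.
have rel i (iI : i \in I) := tight_face_interior irr Fp pI iI.
pose F (k : 'I_#|I|) := tight_face I W x0 (enum_val k).
have Finj : {in [set: 'I_#|I|] &, injective F}.
  move=> k l _ _ Fkl; apply: enum_val_inj; apply/eqP/negPn/negP => kl.
  have [q [Fq qk _]] := rel _ (enum_valP k).
  have [_ /= ql] : F l q by rewrite -Fkl.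
  have := qk _ (enum_valP l); rewrite eq_sym kl => /(_ isT).
  by rewrite ql ltxx.
rewrite -card_le_II (card_le_eql card_II) -(card_le_eqr Pn).
rewrite -(card_le_eql (inj_card_eq Finj)); apply: subset_card_le => _ [k _ <-].
have iI := enum_valP k; have [q [Fq qk [z zW iz]]] := rel _ iI.
exists (\rank (orth W (a (enum_val k)))); split.
- by rewrite -(rank_orth zW iz); exact: affine_hull_dim PW.
- by exists (a (enum_val k)), (b (enum_val k)); split=> // x [_]; exact.
- exact: affine_hull_dim (tight_face_affine_hull Fq qk).
Qed.

End Irredundant.

(** * The bound on the diameter of polyhedra *)

Lemma graph_dist_le (R : realType) T (e : T -> T -> Prop) n u v : reach e n u v ->
  (graph_dist (R := R) e u v <= n%:R%:E)%E.
Proof.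
move=> uv; have [s [us sv sn]] := reach_path uv; apply: (@le_trans _ _ (size s)%:R%:E).
  by apply: ereal_inf_lbound; exists s.
by rewrite lee_fin ler_nat.
Qed.

(** Bounds the diameter by any [G] that satisfies the recursion with an
    inequality.  A polyhedron of dimension [d] with [n] facets is given, inside
    its affine hull, by an irredundant system of at most [n] constraints, whose
    excess over [d] is at most [n - d]. *)
Lemma Delta_u_le (R : realType) (G : nat -> nat) d n :
    (forall k, \sum_(i < k) (2 * G i./2 + 2) <= G k)%N -> (d <= n)%N ->
  (Delta_u R d n <= (G (n - d)%N)%:R%:E)%E.
Proof.
move=> HG dn; apply: ge_ereal_sup => D [m [P [[N [H [HH PE]]]]]].
move=> [v0 v0P] [x0 [U [Ufree PU]]] Pn ->.
have /choice[ab HE] i : exists ab : 'rV[R]_m * R, H i = [set x | dot ab.1 x <= ab.2].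
  by have [a [_ [b ->]]] := HH i; exists (a, b).
pose a i := (ab i).1; pose b i := (ab i).2; pose W := (<<U>>)%MS.
have PW : affine_hull P = [set x | (x - x0 <= W)%MS].
  by rewrite PU; apply/seteqP; split=> x /=; rewrite genmxE.
have rW : \rank W = d by rewrite mxrank_gen; exact/eqP.
have PI : P = [set x | feasible a b [set: 'I_N]%SET W x0 x].
  apply/seteqP; split=> x; rewrite PE /=.
    move=> Px; split; last by move=> i _; have := Px i I; rewrite HE.
    have : affine_hull P x.
      have := @affine_hull2 _ _ P x x 0; rewrite scale0r addr0 PE; exact.
    by rewrite PW.
  by move=> [_ xI] i _; rewrite HE; apply: xI; rewrite finset.in_setT.
have [J irr JE] := irredundant_subsystem a b [set: 'I_N]%SET W x0.
rewrite -JE in PI.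
have Jn : (#|J| <= n)%N.
  have [c [be [_ v0E]]] := v0P; have [Pv0 _] : (P `&` [set x | dot c x = be]) v0.
    by rewrite -v0E.
  by apply: card_le_facets irr _ _ _; rewrite -PI //; exists v0.
rewrite /diameter /graph_diam; apply: ge_ereal_sup => l [u [v [Vu Vv ->]]].
apply: (@le_trans _ _ (staged G (\rank W) (n - d))%:R%:E); last first.
  by rewrite lee_fin ler_nat staged_le.
apply: graph_dist_le; rewrite PI in Vu Vv *.
apply: reach_mono (fun x y => @adjacent_edge _ _ _ a b J W x0 x y) _.
by apply: system_diameter; rewrite ?rW ?subnKC//; apply/vertexP.
Qed.

(** * The series T *)

Section Tseries.
Context {R : realType}.
Implicit Types (s t : R).

Definition Tterm s (L : nat) : R := s ^+ L * 2 ^- (L * L.-1)./2.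

Lemma Tterm_ge0 s L : 0 <= s -> 0 <= Tterm s L.
Proof. by move=> s0; rewrite mulr_ge0 ?exprn_ge0// invr_ge0 exprn_ge0. Qed.

Lemma TtermS s L : Tterm s L.+1 = s * Tterm (s / 2) L.
Proof.
rewrite /Tterm /=; have -> : ((L.+1 * L)./2 = (L * L.-1)./2 + L)%N.
  have -> : (L.+1 * L = L * L.-1 + L.*2)%N by case: L => //= L; nia.
  by rewrite halfD odd_double andbF doubleK.
by rewrite exprD invfM expr_div_n exprS; ring.
Qed.

Lemma partial_TS s n :
  series (Tterm s) n.+1 = 1 + s * series (Tterm (s / 2)) n.
Proof.
rewrite !seriesEord /= big_ord_recl mulr_sumr; congr (_ + _).
  by rewrite /Tterm expr0 mul1r expr0 invr1.
by apply: eq_bigr => i _; rewrite -TtermS.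
Qed.

Lemma partial_T_nd s : 0 <= s -> nondecreasing_seq (series (Tterm s)).
Proof. by move=> s0; apply: nondecreasing_series => n _ _; exact: Tterm_ge0. Qed.

(** Since [T] satisfies [T s = 1 + s T (s / 2)], the bound 2 reproduces itself for
    [s <= 1 / 2]. *)
Lemma partial_T_le2 s n : 0 <= s <= 1 / 2 -> series (Tterm s) n <= 2.
Proof.
elim: n s => [|n IH] s /andP[s0 s1]; first by rewrite /series/= big_geq.
have {}IH : series (Tterm (s / 2)) n <= 2 by apply: IH; lra.
by rewrite partial_TS; nra.
Qed.

Lemma partial_T_bounded s : 0 <= s -> exists M, forall n, series (Tterm s) n <= M.
Proof.
move=> s0; have [j sj] : exists j, s <= 2 ^+ j / 2.
  have [j sj] : exists j : nat, 2 * s <= j%:R.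
    by exists (Num.truncn (2 * s)).+1; rewrite ltW// truncnS_gt.
  exists j; rewrite ler_pdivlMr// mulrC (le_trans sj)// -natrX ler_nat ltnW//.
  exact: ltn_expl.
elim: j s s0 sj => [|j IH] s s0 sj.
  by exists 2 => n; apply: partial_T_le2; rewrite s0 -[X in X / _](expr0 2).
have [||M HM] := IH (s / 2); first by lra.
  by move: sj; rewrite exprS; lra.
have M0 : 0 <= M by have := HM 0%N; rewrite /series/= big_geq.
exists (1 + s * M) => -[|n]; first by rewrite /series/= big_geq// addr_ge0// mulr_ge0.
by rewrite partial_TS lerD2l ler_wpM2l.
Qed.

Lemma is_cvg_T s : 0 <= s -> cvgn (series (Tterm s)).
Proof.
move=> s0; have [M HM] := partial_T_bounded s0.
apply: nondecreasing_is_cvgn; first exact: partial_T_nd.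
by exists M => _ [n _ <-].
Qed.

Lemma partial_T_le s n : 0 <= s -> series (Tterm s) n <= T_ s.
Proof.
by move=> s0; apply: nondecreasing_cvgn_le (is_cvg_T s0) n; exact: partial_T_nd.
Qed.

Lemma T_le s M : 0 <= s -> (forall n, series (Tterm s) n <= M) -> T_ s <= M.
Proof.
by move=> s0 HM; apply: limr_le (is_cvg_T s0) _; apply: nearW.
Qed.

Lemma T_recurrence s : 0 <= s -> T_ s = 1 + s * T_ (s / 2).
Proof.
move=> s0; have s20 : 0 <= s / 2 by lra.
apply: cvg_lim => //; rewrite -cvg_shiftS.
rewrite (_ : (fun n => _) = fun n => 1 + s * series (Tterm (s / 2)) n).
  by apply: cvgD; [exact: cvg_cst|apply: cvgMr; exact: is_cvg_T].
by apply/funext => n; exact: partial_TS.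
Qed.

Lemma T_ge0 s : 0 <= s -> 0 <= T_ s.
Proof. by move=> s0; have := partial_T_le 0 s0; rewrite /series/= big_geq. Qed.

Lemma T_homo s t : 0 <= s -> s <= t -> T_ s <= T_ t.
Proof.
move=> s0 st; have t0 := le_trans s0 st; apply: T_le => // n.
apply: le_trans (partial_T_le n t0); apply: ler_sum => L _.
by rewrite /Tterm ler_wpM2r ?invr_ge0 ?exprn_ge0// lerXn2r// nnegrE.
Qed.

(** The function [2 k T (k / 2)] dominates the recursion: bounding
    [T (i / 4) <= T (k / 4)] in each term makes the sum an arithmetic series,
    at most [k ^ 2 T (k / 4) + 2 k], which is [2 k T (k / 2)] by the functional
    equation. *)
Lemma T_supersolution k :
  \sum_(i < k) (2 * (2 * i./2%:R * T_ (i./2%:R / 2)) + 2) <= 2 * k%:R * T_ (k%:R / 2 : R).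
Proof.
have k0 : 0 <= k%:R :> R by [].
rewrite T_recurrence; last by rewrite divr_ge0.
set t := T_ _; have t0 : 0 <= t by apply: T_ge0; rewrite !divr_ge0.
apply: (@le_trans _ _ (\sum_(i < k) (2 * i%:R * t + 2))).
  apply: ler_sum => i _; rewrite lerD2r.
  have ik : (i <= k)%N by exact: ltnW.
  have i2 : (i./2)%:R <= i%:R / 2 :> R.
    by rewrite ler_pdivlMr// -natrM ler_nat muln2 -{2}(odd_double_half i) leq_addl.
  have {}ik : i%:R <= k%:R :> R by rewrite ler_nat.
  have i0 : 0 <= (i./2)%:R :> R by [].
  have Tt : T_ ((i./2)%:R / 2) <= t by apply: T_homo; lra.
  have := @T_ge0 ((i./2)%:R / 2); rewrite divr_ge0// => /(_ isT) T0.
  nra.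
rewrite big_split/= sumr_const card_ord -mulr_suml -mulr_sumr.
have -> : \sum_(i < k) i%:R = (k%:R * (k%:R - 1)) / 2 :> R.
  elim: k {k0 t t0} => [|k IH]; first by rewrite big_ord0 !mul0r.
  by rewrite big_ord_recr/= IH -natr1; field.
rewrite -mulr_natr.
by nra.
Qed.

End Tseries.

(** * Growth of T *)

Section Growth.
Context {R : realType}.
Implicit Types (s : R).

(** The exact solution of the homogeneous equation [f s = s f (s / 2)] of which [T]
    solves the inhomogeneous version, and the size of the largest terms of [T]:
    with [x = log2 s + 1 / 2], the term of index [L] is
    [2 ^ (x ^ 2 / 2) 2 ^ (- (L - x) ^ 2 / 2)]. *)
Definition gauss s : R := expR (ln 2 / 2 * (ln s / ln 2 + 1 / 2) ^+ 2).

Lemma ln2_gt0 : 0 < ln 2 :> R.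
Proof. by apply: ln_gt0; rewrite ltr1n. Qed.

Lemma gauss_half s : 0 < s -> gauss s = s * gauss (s / 2).
Proof.
move=> s0; have a0 := ln2_gt0; rewrite -{2}[s]lnK ?posrE// -expRD /gauss.
rewrite ln_div ?posrE//; congr expR; field; lra.
Qed.

Lemma gauss_ge1 s : 1 <= gauss s.
Proof. by rewrite -expR0 ler_expR mulr_ge0 ?sqr_ge0// divr_ge0// ltW// ln2_gt0. Qed.

(** By induction along halvings of [s]; subtracting 1 absorbs the inhomogeneous
    term 1 as soon as [s >= 2].  The factor 8 comes from [T 2 <= 7]. *)
Lemma T_le_gauss s : 1 <= s -> T_ s <= 8 * gauss s - 1.
Proof.
have base t : 1 <= t <= 2 -> T_ t <= 8 * gauss t - 1.
  move=> /andP[t1 t2]; have g1 := gauss_ge1 t.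
  have T2 : T_ t <= T_ 2 by apply: T_homo; lra.
  have half : T_ (2 / 2 / 2) <= 2 :> R.
    by apply: T_le => [|n]; [lra|apply: partial_T_le2; lra].
  have := @T_recurrence R 2; have := @T_recurrence R (2 / 2).
  by move=> /(_ ltac:(lra)) T1 /(_ ltac:(lra)); lra.
move=> s1; have [j sj] : exists j, s <= 2 ^+ j.
  exists (Num.truncn s).+1; apply: (@le_trans _ _ (Num.truncn s).+1%:R).
    by rewrite ltW// truncnS_gt.
  by rewrite -natrX ler_nat ltnW// ltn_expl.
elim: j s s1 sj => [|j IH] s s1 sj; first by apply: base; rewrite expr0 in sj; lra.
have [s2|s2] := leP s 2; first by apply: base; rewrite s1.
rewrite T_recurrence 1?gauss_half; [|lra|lra].
by have := IH (s / 2); rewrite exprS in sj; move=> /(_ ltac:(lra) ltac:(lra)); nra.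
Qed.

End Growth.

(** * The constants *)

Section Constants.
Context {R : realType}.

Lemma lambda4_gt0 : 0 < lambda4 R.
Proof. by apply: powR_gt0; lra. Qed.

Lemma lambda4_ge_half : 1 / 2 <= lambda4 R.
Proof.
have -> : 1 / 2 = ((1 / 2) ^+ 4) `^ (1 / 4) :> R.
  rewrite -powR_mulrn; last by lra.
  rewrite -powRrM; have -> : 4%:R * (1 / 4) = 1 :> R by field.
  by rewrite powRr1//; lra.
by apply: ge0_ler_powR; rewrite ?nnegrE; lra.
Qed.

(** Certified repeated squaring: a lower bound [c] of [exp x] is squared, and
    rounded down to an entry of the list, as many times as the list is long. *)
Lemma expR_square_chain (x c : R) (cs : seq R) : 0 <= c -> c <= expR x ->
  path (fun p q => (0 <= q) && (q <= p ^+ 2)) c cs ->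
  last c cs <= expR (x * 2 ^+ size cs).
Proof.
elim: cs x c => [|d cs IH] x c c0 cx /=; first by rewrite expr0 mulr1.
move=> /andP[/andP[d0 dc] cs_path]; rewrite exprS mulrA; apply: IH => //.
rewrite mulrC mulr_natl mulr2n expRD -expr2; apply: le_trans dc _.
by rewrite lerXn2r// nnegrE expR_ge0.
Qed.

(** The list holds good rational approximations from below of the iterated squares
    of [2954 / 2953], which is at most [exp (1 / 2953)]; the last one is 2. *)
Lemma ln2_le : ln 2 <= 2048 / 2953 :> R.
Proof.
rewrite -ler_expR lnK ?posrE//.
have := @expR_square_chain (1 / 2953) (2954 / 2953) [:: 4432 / 4429; 739 / 738;
  4807 / 4794; 4073 / 4051; 4641 / 4591; 3033 / 2968; 4929 / 4720; 1783 / 1635;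
  729 / 613; 2021 / 1429; 2].
have -> : 1 / 2953 * 2 ^+ 11 = 2048 / 2953 :> R by field.
apply; first by lra.
  by apply: le_trans (expR_ge1Dx _); lra.
by rewrite /= ?andbT; repeat (apply/andP; split); lra.
Qed.

Lemma ln2_ge : 1024 / 1479 <= ln 2 :> R.
Proof.
rewrite -ler_expR lnK ?posrE// -lef_pV2 ?posrE ?expR_gt0// -expRN.
have := @expR_square_chain (- (1 / 1479)) (1478 / 1479) [:: 1477 / 1479;
  369 / 370; 737 / 741; 735 / 743; 731 / 747; 1175 / 1227; 1448 / 1579;
  423 / 503; 913 / 1291; 2^-1].
have -> : - (1 / 1479) * 2 ^+ 10 = - (1024 / 1479) :> R by field.
apply; first by lra.
  by apply: le_trans (expR_ge1Dx _); lra.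
by rewrite /= ?andbT; repeat (apply/andP; split); lra.
Qed.

(** Since [181 ^ 2] is very close to [2 ^ 15], the constant is 9/8 up to a tiny
    correction, for which crude bounds of [ln 2] are enough. *)
Lemma c4E : c4 R = 9 / 8 - ln (2 ^+ 15 / 181 ^+ 2) / (8 * ln 2).
Proof.
have a0 := @ln2_gt0 R; have p181 : 0 < 181 :> R by lra.
have p2 : 0 < 2 :> R by lra.
have -> : c4 R = 3 / 2 + 1 / 4 * (ln 181 - 9 * ln 2) / ln 2.
  rewrite /c4 /log2 ln_powR; have -> : 181 / 512 = 181 / 2 ^+ 9 :> R by field.
  by rewrite ln_div ?posrE ?exprn_gt0// lnXn//; field; rewrite gt_eqF.
rewrite ln_div ?posrE ?exprn_gt0// !lnXn//.
by field; rewrite gt_eqF.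
Qed.

Lemma c4_bounds : 1 + 1249 / 10 ^+ 4 + 614 / 10 ^+ 7 <= c4 R
                  < 1 + 1249 / 10 ^+ 4 + 615 / 10 ^+ 7.
Proof.
have a0 := @ln2_gt0 R; have aub := ln2_le; have alb := ln2_ge.
have p181 : 0 < 181 :> R by lra.
have p2 : 0 < 2 :> R by lra.
have q0 : 0 < 2 ^+ 15 / 181 ^+ 2 :> R by rewrite divr_gt0// exprn_gt0.
rewrite c4E; set y := ln _.
have yub : y <= 7 / 181 ^+ 2.
  have -> : 7 / 181 ^+ 2 = 2 ^+ 15 / 181 ^+ 2 - 1 :> R by field.
  by rewrite lerBrDl -[leRHS](lnK q0); exact: expR_ge1Dx.
have ylb : 7 / 2 ^+ 15 <= y.
  have : 1 - y <= (2 ^+ 15 / 181 ^+ 2)^-1.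
    by rewrite -[leRHS]lnK ?posrE ?invr_gt0// lnV//; exact: expR_ge1Dx.
  have -> : (2 ^+ 15 / 181 ^+ 2)^-1 = 1 - 7 / 2 ^+ 15 :> R by field.
  by lra.
clearbody y; clear q0 p181 p2; apply/andP; split.
  suff : y / (8 * ln 2) <= 386 / 10 ^+ 7 by lra.
  by rewrite ler_pdivrMr; lra.
suff : 385 / 10 ^+ 7 < y / (8 * ln 2) by lra.
by rewrite ltr_pdivlMr; lra.
Qed.

End Constants.

(** * The two bounds *)

Lemma Delta_u_le_T (R : realType) d n : (4 <= n - d)%N ->
  (Delta_u R d n <=
     (2 * (n - d)%:R * T_ (lambda4 R * (n - d)%:R))%:E)%E.
Proof.
move=> nd; pose g k : R := 2 * k%:R * T_ (k%:R / 2).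
have g0 k : 0 <= g k by rewrite !mulr_ge0// T_ge0// divr_ge0.
have HG k : (\sum_(i < k) (2 * Num.truncn (g i./2) + 2) <= Num.truncn (g k))%N.
  rewrite truncn_ge_nat//; apply: le_trans (T_supersolution k).
  rewrite natr_sum; apply: ler_sum => i _.
  by rewrite natrD natrM lerD2r ler_wpM2l// truncn_le.
apply: (le_trans (@Delta_u_le R (fun k => Num.truncn (g k)) d n HG _)).
  by lia.
rewrite lee_fin (@le_trans _ _ (g (n - d)%N))//; first by rewrite truncn_le.
rewrite ler_wpM2l ?mulr_ge0// T_homo ?divr_ge0//.
by rewrite mulrC ler_wpM2r// -[2^-1]mul1r lambda4_ge_half.
Qed.

(** With [l = log2 lambda4], expanding the square [(log2 k + l + 1 / 2) ^ 2 / 2] in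
    the exponent of [gauss (lambda4 k)] leaves [(log2 k) ^ 2 / 2], then
    [(l + 1 / 2) log2 k], which with the factor [k] in front gives
    [c4 = 3 / 2 + l], and a constant, which is the error term. *)
Lemma T_lambda4_powR (R : realType) (k : R) : 4 <= k ->
  2 * k * T_ (lambda4 R * k) <= k `^ (1 / 2 * log2 k + c4 R +
    (ln 16 + ln 2 / 2 * (ln (lambda4 R) / ln 2 + 1 / 2) ^+ 2) / ln k).
Proof.
move=> k4; have k0 : 0 < k by lra.
have l0 := lambda4_gt0 (R := R); have lh := lambda4_ge_half (R := R).
have lk1 : 1 <= lambda4 R * k by nra.
have a0 := @ln2_gt0 R; have lnk0 : 0 < ln k by apply: ln_gt0; lra.
apply: (@le_trans _ _ (16 * k * gauss (lambda4 R * k))).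
  by have := T_le_gauss lk1; nra.
have -> : 16 * k * gauss (lambda4 R * k) =
    expR (ln 16 + ln k + ln 2 / 2 * (ln (lambda4 R * k) / ln 2 + 1 / 2) ^+ 2).
  by rewrite expRD [expR (ln 16 + _)]expRD !lnK ?posrE.
rewrite /powR gt_eqF// ler_expR.
rewrite lnM ?posrE// /c4 /log2 le_eqVlt; apply/orP; left; apply/eqP.
by field; rewrite !gt_eqF.
Qed.

Theorem theorem13 (R : realType) :
  [/\ 1 + 1249 / 10 ^+ 4 + 614 / 10 ^+ 7 <= c4 R < 1 + 1249 / 10 ^+ 4 + 615 / 10 ^+ 7,
      exists C4 : R, forall d n : nat, (4 <= n - d)%N ->
        (Delta_u R d n <= (C4 * (n - d)%:R * T_ (lambda4 R * (n - d)%:R))%:E)%E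
    & exists K : R, forall d n : nat, (4 <= n - d)%N ->
        exists err : R, `|err| <= K / ln (n - d)%:R /\
          (Delta_u R d n <=
             ((n - d)%:R `^ (1 / 2 * log2 (n - d)%:R + c4 R + err))%:E)%E].
Proof.
split; first exact: c4_bounds.
  by exists 2 => d n; exact: Delta_u_le_T.
pose K : R := ln 16 + ln 2 / 2 * (ln (lambda4 R) / ln 2 + 1 / 2) ^+ 2.
have K0 : 0 <= K.
  apply: addr_ge0; first by apply: ln_ge0; lra.
  apply: mulr_ge0; last exact: sqr_ge0.
  by apply: divr_ge0 => //; exact/ltW/ln2_gt0.
exists K => d n nd; have k4 : 4 <= (n - d)%:R :> R by rewrite ler_nat.
have lnk0 : 0 <= ln (n - d)%:R :> R by apply: ln_ge0; lra.
exists (K / ln (n - d)%:R); split; first by rewrite ger0_norm// divr_ge0.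
by apply: le_trans (Delta_u_le_T R nd) _; rewrite lee_fin T_lambda4_powR.
Qed.
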